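(* $$\left(3\left(\frac{2\pi e^{\gamma}}{A^{12}}\right)^{2}\right)^{\frac{\pi^2}{18}}=\prod_{m=1}^{\infty}\frac{(3m)^{\frac{1}{(3m)^2}}\cdot(3m)^{\frac{1}{(3m)^2}}}{(3m-1)^{\frac{1}{(3m-1)^2}}\cdot(3m+1)^{\frac{1}{(3m+1)^2}}}=\frac{3^{\frac{1}{3^2}}\cdot3^{\frac{1}{3^2}}}{2^{\frac{1}{2^2}}\cdot4^{\frac{1}{4^2}}}\,\frac{6^{\frac{1}{6^2}}\cdot6^{\frac{1}{6^2}}}{5^{\frac{1}{5^2}}\cdot7^{\frac{1}{7^2}}}\,\frac{9^{\frac{1}{9^2}}\cdot9^{\frac{1}{9^2}}}{8^{\frac{1}{8^2}}\cdot10^{\frac{1}{10^2}}}\cdots .$$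
   Context: $\gamma=0.5772156649\ldots$ is the Euler–Mascheroni constant and $A=1.2824271291\ldots$ is the Glaisher–Kinkelin constant, $A=\lim_{n\to\infty}\dfrac{\prod_{k=1}^{n}k^k}{n^{n^2/2+n/2+1/12}\,e^{-n^2/4}}$ (equivalently $\log A=\frac1{12}-\zeta'(-1)$ with $\zeta$ the Riemann zeta function). The infinite product is the limit of its partial products over $m$. *)

(* Defs.v *)
From Stdlib Require Import Reals.
From Coquelicot Require Import Coquelicot.
Open Scope R_scope.

Definition euler_gamma : R :=
  real (Lim_seq (fun n => sum_n_m (fun k => / INR k) 1 n - ln (INR n))).

(* The product starts at [k = 0], which is harmless since [INR 0 ^ 0 = 1]. *)
Definition glaisher_A : R :=
  real (Lim_seq (fun n =>
    prod_f_R0 (fun k => INR k ^ k) n /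
    (Rpower (INR n) (INR n ^ 2 / 2 + INR n / 2 + 1 / 12) *
     exp (- (INR n ^ 2 / 4))))).

(* [x ^ (1 / x ^ 2)] with a real exponent; only meaningful for [0 < x]. *)
Definition root_sq (x : R) : R := Rpower x (1 / x ^ 2).

Definition wallis_factor (m : nat) : R :=
  (root_sq (3 * INR m) * root_sq (3 * INR m)) /
  (root_sq (3 * INR m - 1) * root_sq (3 * INR m + 1)).

(* Main.v *)
Require Import Defs.
From Stdlib Require Import Reals Lra Lia.
From Coquelicot Require Import Coquelicot.
Open Scope R_scope.

(** Put [L = sum ln n / n^2]. In the logarithm of the product the integer [n]
    contributes [- ln n / n^2], and multiples of [3] contribute an additional
    [3 ln n / n^2]; since [sum 1 / n^2 = PI^2 / 6], the logarithm converges to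
    [(ln 3 * PI^2 / 6 + L) / 3 - L]. What remains is the evaluation
    [L = PI^2 / 6 * (12 ln A - gamma - ln (2 PI))], the classical value of
    [- zeta'(2)], where [A] is the Glaisher-Kinkelin constant. It is
    obtained here without the functional equation of zeta, by computing in two
    ways the integral over [[0, N * PI]] of

      [ p t / t = sum_k (1 - cos (2 k t)) / (k^2 t) ],

    where [p] is the [PI]-periodic function equal to [t (PI - t)] on [[0, PI]],
    whose Fourier series is the sum on the right ([parabola_series_eq]; its
    value at [PI / 2] also gives the Basel sum).

    On the one hand, [p t / t] is on each period a combination of [t], [1] and
    [1 / t]. Summing the elementary integrals by parts produces
    [sum_(k <= N) k ln k], and the total is [PI^2] times [glaisher_log N], which
    is [2 ln A_N + ln N / 6] for the quotient [A_N] whose limit defines [A]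
    ([cin_sum_lim]).

    On the other hand, the integral of the [k]-th term is [Cin (2 k N PI) / k^2],
    where [Cin x] is the integral of [(1 - cos s) / s] over [[0, x]], and
    [Cin (2 M PI) = ln M + gamma + ln (2 PI) + o(1)] ([cin_log_lim]). As [k N]
    is at least [N], the error is small uniformly in [k], so that the total is
    [PI^2 / 6 * (ln N + gamma + ln (2 PI)) + L + o(1)].

    Comparison gives both the convergence of [A_N] and the value of its limit
    ([glaisher_A_eq]). All integrals are handled through their derivatives and
    the mean value inequality. *)

(** * Sums and limits *)


Lemma sum_n_succ (f : nat -> R) n :
  sum_n f (S n) = sum_n f n + f (S n) :> R.
Proof. exact (sum_Sn f n). Qed.

Lemma sum_n_le (f g : nat -> R) n :
  (forall k, f k <= g k) -> sum_n f n <= sum_n g n.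
Proof.
  intros H; induction n as [|n IH]; [now rewrite !sum_O |].
  rewrite !sum_n_succ; specialize (H (S n)); lra.
Qed.

Lemma sum_n_scal (c : R) (f : nat -> R) n :
  sum_n (fun k => c * f k) n = c * sum_n f n :> R.
Proof. exact (sum_n_mult_l c f n). Qed.

Lemma is_lim_seq_squeeze0 (u v : nat -> R) (l : R) :
  (forall n, Rabs (u n - l) <= v n) -> is_lim_seq v 0 -> is_lim_seq u l.
Proof.
  intros H Hv.
  apply is_lim_seq_le_le with (u := fun n => l - v n) (w := fun n => l + v n).
  - intros n; specialize (H n); apply Rabs_le_between in H; lra.
  - replace (Finite l) with (Finite (l - 0)) by (f_equal; ring).
    apply is_lim_seq_minus'; [apply is_lim_seq_const | exact Hv].
  - replace (Finite l) with (Finite (l + 0)) by (f_equal; ring).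
    apply is_lim_seq_plus'; [apply is_lim_seq_const | exact Hv].
Qed.

Lemma is_lim_seq_inv_linear (c a b : R) :
  0 < a -> is_lim_seq (fun n => c / (a * INR n + b)) 0.
Proof.
  intros Ha.
  replace (Finite 0) with (Rbar_mult c 0) by (simpl; f_equal; ring).
  apply is_lim_seq_scal_l.
  change (Finite 0) with (Rbar_inv p_infty).
  apply is_lim_seq_inv; [| discriminate].
  apply is_lim_seq_plus with (l1 := p_infty) (l2 := b).
  - replace p_infty with (Rbar_mult a p_infty).
    + apply is_lim_seq_scal_l, is_lim_seq_INR.
    + simpl; destruct (Rle_dec 0 a) as [H|H]; [|lra].
      destruct (Rle_lt_or_eq_dec 0 a H); [reflexivity | lra].
  - apply is_lim_seq_const.
  - reflexivity.
Qed.

(** The derivative is prescribed inside the interval only: the formulas for it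
    that are used below divide by [x], and break down at a left endpoint [0]. *)
Lemma mean_value_bound (f df : R -> R) (a b B : R) :
  a <= b -> 0 <= B ->
  (forall x, a < x < b -> is_derive f x (df x)) ->
  (forall x, a <= x <= b -> continuity_pt f x) ->
  (forall x, a < x < b -> Rabs (df x) <= B) ->
  Rabs (f b - f a) <= B * (b - a).
Proof.
  intros Hab HB Hd Hc Hbd.
  pose (dg := fun x => if Rlt_dec a x then
                         if Rlt_dec x b then df x else 0 else 0).
  destruct (MVT_gen f a b dg) as [c [_ ->]].
  - rewrite Rmin_left, Rmax_right by lra; intros x Hx; unfold dg.
    destruct (Rlt_dec a x); [|lra]; destruct (Rlt_dec x b); [|lra].
    now apply Hd.
  - rewrite Rmin_left, Rmax_right by lra; exact Hc.
  - rewrite Rabs_mult, (Rabs_pos_eq (b - a)) by lra.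
    apply Rmult_le_compat_r; [lra|]; unfold dg.
    destruct (Rlt_dec a c); [destruct (Rlt_dec c b)|];
      [apply Hbd; lra | |]; rewrite Rabs_R0; exact HB.
Qed.

Lemma is_derive_continuity_pt (f : R -> R) x d :
  is_derive f x d -> continuity_pt f x.
Proof.
  intros H; apply continuity_pt_filterlim.
  apply (ex_derive_continuous f x); now exists d.
Qed.

(** * Convergence of the inverse squares *)

Definition inv_sq (k : nat) : R := / INR (S k) ^ 2.

Lemma INR_S_pos k : 0 < INR (S k).
Proof. apply lt_0_INR; lia. Qed.

Lemma inv_sq_pos k : 0 < inv_sq k.
Proof. apply Rinv_0_lt_compat, pow_lt, INR_S_pos. Qed.

Lemma ex_series_inv_sq : ex_series inv_sq.
Proof.
  destruct (ex_finite_lim_seq_incr (sum_n inv_sq) 2) as [l Hl].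
  - intros n; rewrite sum_n_succ; pose proof (inv_sq_pos (S n)); lra.
  - intros n.
    enough (sum_n inv_sq n <= 2 - / INR (S n)) as H.
    { pose proof (Rinv_0_lt_compat _ (INR_S_pos n)); lra. }
    induction n as [|n IH].
    + rewrite sum_O; unfold inv_sq; simpl; lra.
    + rewrite sum_n_succ.
      enough (inv_sq (S n) <= / INR (S n) - / INR (S (S n))) by lra.
      unfold inv_sq; rewrite (S_INR (S n)).
      pose proof (INR_S_pos n) as Hx; set (x := INR (S n)) in *.
      apply Rminus_le_0.
      replace (/ x - / (x + 1) - / (x + 1) ^ 2) with (/ (x * (x + 1) ^ 2))
        by (field; lra).
      apply Rlt_le, Rinv_0_lt_compat, Rmult_lt_0_compat; [lra|].
      apply pow_lt; lra.
  - now exists l.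
Qed.

Lemma ex_series_bounded_inv_sq (c : nat -> R) (B : R) :
  (forall k, Rabs (c k) <= B) -> ex_series (fun k => c k * inv_sq k).
Proof.
  intros H.
  apply (ex_series_le (fun k => c k * inv_sq k) (fun k => B * inv_sq k)).
  - intros k; change (Rabs (c k * inv_sq k) <= B * inv_sq k).
    pose proof (inv_sq_pos k).
    rewrite Rabs_mult, (Rabs_pos_eq (inv_sq k)) by lra.
    apply Rmult_le_compat_r; [lra | apply H].
  - destruct ex_series_inv_sq as [l Hl].
    exists (B * l); exact (is_series_scal B inv_sq l Hl).
Qed.

Definition inv_sq_tail (n : nat) : R := Series inv_sq - sum_n inv_sq n.

Lemma inv_sq_tail_lim : is_lim_seq inv_sq_tail 0.
Proof.
  replace (Finite 0) with (Finite (Series inv_sq - Series inv_sq))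
    by (f_equal; ring).
  apply is_lim_seq_minus'; [apply is_lim_seq_const|].
  exact (Series_correct _ ex_series_inv_sq).
Qed.

(** The bound on the remainder involves the coefficients only through [B]: this
    is what makes the tails of the Fourier series uniformly small. *)
Lemma partial_sum_bounds (c : nat -> R) (B l : R) (n : nat) :
  (forall k, 0 <= c k <= B) -> is_series (fun k => c k * inv_sq k) l ->
  0 <= l - sum_n (fun k => c k * inv_sq k) n <= B * inv_sq_tail n.
Proof.
  intros Hc Hl; unfold inv_sq_tail.
  set (u := fun k => c k * inv_sq k) in *.
  assert (Hu : forall m, 0 <= sum_n u (n + m) - sum_n u n
                         <= B * (sum_n inv_sq (n + m) - sum_n inv_sq n)).
  { induction m as [|m IH]; [rewrite Nat.add_0_r; lra|].
    rewrite Nat.add_succ_r, !sum_n_succ.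
    pose proof (inv_sq_pos (S (n + m))) as Hq.
    destruct (Hc (S (n + m))) as [H1 H2].
    assert (0 <= u (S (n + m)) <= B * inv_sq (S (n + m))) by (unfold u; nra).
    nra. }
  assert (Hshift : forall m, (n + m = m + n)%nat) by (intros; lia).
  assert (L1 : is_lim_seq (fun m => sum_n u (n + m) - sum_n u n)
                          (l - sum_n u n)).
  { apply is_lim_seq_minus'; [|apply is_lim_seq_const].
    apply is_lim_seq_ext with (fun m => sum_n u (m + n)).
    - intros m; now rewrite Hshift.
    - now apply (is_lim_seq_incr_n (sum_n u) n). }
  assert (L2 : is_lim_seq
                 (fun m => B * (sum_n inv_sq (n + m) - sum_n inv_sq n))
                 (B * (Series inv_sq - sum_n inv_sq n))).
  { apply is_lim_seq_mult'; [apply is_lim_seq_const|].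
    apply is_lim_seq_minus'; [|apply is_lim_seq_const].
    apply is_lim_seq_ext with (fun m => sum_n inv_sq (m + n)).
    - intros m; now rewrite Hshift.
    - apply (is_lim_seq_incr_n (sum_n inv_sq) n).
      exact (Series_correct _ ex_series_inv_sq). }
  split.
  - exact (is_lim_seq_le _ _ 0 _ (fun m => proj1 (Hu m))
             (is_lim_seq_const 0) L1).
  - exact (is_lim_seq_le _ _ _ _ (fun m => proj2 (Hu m)) L1 L2).
Qed.

(** * The Fourier series of a parabola *)

Lemma one_minus_cos x : 1 - cos x = 2 * sin (x / 2) ^ 2.
Proof.
  replace x with (2 * (x / 2)) at 1 by field.
  rewrite cos_2a_sin; ring.
Qed.

Lemma one_minus_cos_range x : 0 <= 1 - cos x <= 2.
Proof. pose proof (COS_bound x); lra. Qed.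

Lemma abs_sin_le x : Rabs (sin x) <= Rabs x.
Proof.
  assert (H : forall y, 0 <= y -> Rabs (sin y) <= y).
  { intros y Hy; replace y with (1 * (y - 0)) at 2 by ring.
    replace (sin y) with (sin y - sin 0) by (rewrite sin_0; ring).
    apply mean_value_bound with cos; try lra.
    - intros x0 _; apply is_derive_sin.
    - intros x0 _; apply continuity_sin.
    - intros x0 _; apply Rabs_le; pose proof (COS_bound x0); lra. }
  destruct (Rle_dec 0 x) as [Hx|Hx].
  - rewrite (Rabs_pos_eq x) by lra; auto.
  - rewrite <- (Rabs_Ropp x), (Rabs_pos_eq (- x)) by lra.
    rewrite <- Rabs_Ropp, <- sin_neg; apply H; lra.
Qed.

Lemma one_minus_cos_le_sq x : 1 - cos x <= x ^ 2 / 2.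
Proof.
  rewrite one_minus_cos.
  pose proof (pow_maj_Rabs _ _ 2 (abs_sin_le (x / 2))) as H.
  rewrite pow2_abs in H; lra.
Qed.

Definition parabola_sum (K : nat) (t : R) : R :=
  sum_n (fun k => (1 - cos (2 * INR (S k) * t)) * inv_sq k) K.

(** Summing the geometric progression: the Dirichlet kernel. *)
Lemma dirichlet_kernel K t :
  sin t * (1 + 2 * sum_n (fun k => cos (2 * INR (S k) * t)) K) =
  sin ((2 * INR K + 3) * t).
Proof.
  induction K as [|K IH].
  - rewrite sum_O; replace (INR 1) with 1 by reflexivity.
    replace (INR 0) with 0 by reflexivity.
    replace ((2 * 0 + 3) * t) with (2 * 1 * t + t) by ring.
    replace (2 * 1 * t) with (2 * t) by ring.
    rewrite sin_plus, sin_2a, cos_2a.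
    pose proof (sin2_cos2 t) as H; unfold Rsqr in H.
    replace (2 * sin t * cos t * cos t) with (2 * sin t * (cos t * cos t)) by ring.
    replace (cos t * cos t) with (1 - sin t * sin t) by lra; ring.
  - rewrite sum_n_succ, Rmult_plus_distr_l, (Rmult_plus_distr_l 2).
    set (s := 2 * sum_n _ K) in *.
    assert (E : sin t * s = sin ((2 * INR K + 3) * t) - sin t) by lra.
    rewrite (Rmult_plus_distr_l (sin t) s), E, !S_INR.
    replace ((2 * (INR K + 1) + 3) * t) with (2 * (INR K + 1 + 1) * t + t) by ring.
    replace ((2 * INR K + 3) * t) with (2 * (INR K + 1 + 1) * t - t) by ring.
    rewrite sin_plus, sin_minus; ring.
Qed.

Lemma cos_odd_half_pi n : cos ((2 * INR n + 1) * (PI / 2)) = 0.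
Proof.
  replace ((2 * INR n + 1) * (PI / 2)) with (PI / 2 + INR n * PI) by field.
  induction n as [|n IH].
  - replace (PI / 2 + INR 0 * PI) with (PI / 2) by (simpl; ring). apply cos_PI2.
  - rewrite S_INR.
    replace (PI / 2 + (INR n + 1) * PI) with (PI / 2 + INR n * PI + PI) by ring.
    rewrite neg_cos, IH; ring.
Qed.

Lemma sin_INR_PI n : sin (INR n * PI) = 0.
Proof.
  induction n as [|n IH]; [simpl; now rewrite Rmult_0_l, sin_0|].
  rewrite S_INR, Rmult_plus_distr_r, Rmult_1_l, neg_sin, IH; ring.
Qed.

Lemma sum_n_zero (f : nat -> R) n : (forall k, f k = 0) -> sum_n f n = 0 :> R.
Proof.
  intros H; induction n as [|n IH]; [now rewrite sum_O|].
  rewrite sum_n_succ, IH, H; ring.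
Qed.

(** The derivative of the difference between the partial sum and the
    parabola. *)
Definition sawtooth_defect (K : nat) (t : R) : R :=
  sum_n (fun k => 2 * sin (2 * INR (S k) * t) / INR (S k)) K - (PI - 2 * t).

Lemma is_derive_parabola_defect K t :
  is_derive (fun x => parabola_sum K x - x * (PI - x)) t (sawtooth_defect K t).
Proof.
  unfold sawtooth_defect.
  apply (is_derive_minus (parabola_sum K) (fun x => x * (PI - x))).
  - apply (is_derive_sum_n
      (fun k x => (1 - cos (2 * INR (S k) * x)) * inv_sq k)).
    intros k _; unfold inv_sq.
    generalize (INR (S k)) (INR_S_pos k); intros c Hc.
    auto_derive; [trivial | field; lra].
  - auto_derive; [trivial | ring].
Qed.

Lemma is_derive_sawtooth_defect K t :
  is_derive (sawtooth_defect K) t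
    (2 * (1 + 2 * sum_n (fun k => cos (2 * INR (S k) * t)) K)).
Proof.
  replace (2 * (1 + 2 * sum_n (fun k => cos (2 * INR (S k) * t)) K))
    with (4 * sum_n (fun k => cos (2 * INR (S k) * t)) K - (-2)) by ring.
  rewrite <- sum_n_scal.
  apply (is_derive_minus
    (fun x => sum_n (fun k => 2 * sin (2 * INR (S k) * x) / INR (S k)) K)
    (fun x => PI - 2 * x)).
  - apply (is_derive_sum_n
      (fun k x => 2 * sin (2 * INR (S k) * x) / INR (S k))).
    intros k _; generalize (INR (S k)) (INR_S_pos k); intros c Hc.
    auto_derive; [trivial | field; lra].
  - auto_derive; [trivial | ring].
Qed.

Lemma half_pi_sin_pos a t : 0 < a -> a <= t <= PI / 2 -> 0 < sin a <= sin t.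
Proof.
  intros Ha Ht; pose proof PI_RGT_0; split.
  - apply sin_gt_0; lra.
  - apply sin_incr_1; lra.
Qed.

(** The derivative of the defect is [2 sin (w t) / sin t] with [w = 2 K + 3].
    This is integration by parts in disguise: subtracting the oscillating term
    [- 2 cos (w t) / (w sin t)] leaves a function whose derivative is of
    order [1 / w]. *)
Lemma sawtooth_defect_bound K a t :
  0 < a -> a <= t <= PI / 2 ->
  Rabs (sawtooth_defect K t) <= (PI + 2) / sin a ^ 2 / (2 * INR K + 3).
Proof.
  intros Ha Ht; set (w := 2 * INR K + 3).
  pose proof PI_RGT_0 as HPI.
  assert (Hw : 0 < w) by (unfold w; pose proof (pos_INR K); lra).
  assert (Hsa : 0 < sin a) by (apply sin_gt_0; lra).
  assert (Hs : forall x, a <= x <= PI / 2 -> sin a <= sin x <= 1).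
  { intros x Hx; split; [now apply half_pi_sin_pos | apply SIN_bound]. }
  pose (W := fun x => sawtooth_defect K x + 2 * cos (w * x) / (w * sin x)).
  pose (dW := fun x => - 2 * cos (w * x) * cos x / (w * sin x ^ 2)).
  assert (HdW : forall x, a <= x <= PI / 2 -> is_derive W x (dW x)).
  { intros x Hx; pose proof (Hs x Hx).
    replace (dW x) with
      (2 * (1 + 2 * sum_n (fun k => cos (2 * INR (S k) * x)) K)
       + (dW x - 2 * sin (w * x) / sin x)).
    - apply (is_derive_plus (sawtooth_defect K)
              (fun x => 2 * cos (w * x) / (w * sin x))).
      + apply is_derive_sawtooth_defect.
      + unfold dW; auto_derive; [nra|].
        pose proof (sin2_cos2 x) as E; unfold Rsqr in E.
        field; lra.
    - unfold w; rewrite <- dirichlet_kernel; field; lra. }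
  (* At [PI / 2] all sines, the sawtooth and the correction vanish. *)
  assert (Hpi2 : W (PI / 2) = 0).
  { unfold W, sawtooth_defect, w.
    replace (2 * INR K + 3) with (2 * INR (S K) + 1) by (rewrite S_INR; ring).
    replace (PI - 2 * (PI / 2)) with 0 by field.
    rewrite cos_odd_half_pi, sum_n_zero; [unfold Rdiv; ring|].
    intros k; replace (2 * INR (S k) * (PI / 2)) with (INR (S k) * PI) by field.
    rewrite sin_INR_PI; unfold Rdiv; ring. }
  assert (Hinv : 0 < / (w * sin a ^ 2)).
  { apply Rinv_0_lt_compat, Rmult_lt_0_compat; [lra | apply pow_lt; lra]. }
  assert (HW : Rabs (W t) <= PI / (w * sin a ^ 2)).
  { replace (W t) with (- (W (PI / 2) - W t)) by (rewrite Hpi2; ring).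
    rewrite Rabs_Ropp.
    apply Rle_trans with (2 * / (w * sin a ^ 2) * (PI / 2 - t)).
    - apply mean_value_bound with dW; try lra.
      + intros x Hx; apply HdW; lra.
      + intros x Hx; eapply is_derive_continuity_pt, HdW; lra.
      + intros x Hx; unfold dW, Rdiv.
        assert (Hsx := Hs x ltac:(lra)).
        assert (0 < w * sin a ^ 2) by (apply Rmult_lt_0_compat; [lra | nra]).
        assert (w * sin a ^ 2 <= w * sin x ^ 2).
        { apply Rmult_le_compat_l; [lra|]; apply pow_incr; lra. }
        rewrite Rabs_mult, (Rabs_pos_eq (/ _))
          by (apply Rlt_le, Rinv_0_lt_compat; lra).
        apply Rmult_le_compat; [apply Rabs_pos | | |].
        * apply Rlt_le, Rinv_0_lt_compat; lra.
        * apply Rabs_le; pose proof (COS_bound (w * x)); pose proof (COS_bound x).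
          nra.
        * apply Rinv_le_contravar; lra.
    - unfold Rdiv; nra. }
  replace (sawtooth_defect K t) with (W t - 2 * cos (w * t) / (w * sin t))
    by (unfold W; ring).
  assert (Hst := Hs t ltac:(lra)).
  assert (HC : Rabs (2 * cos (w * t) / (w * sin t)) <= 2 / (w * sin a ^ 2)).
  { unfold Rdiv; rewrite Rabs_mult, (Rabs_pos_eq (/ _))
      by (apply Rlt_le, Rinv_0_lt_compat, Rmult_lt_0_compat; lra).
    assert (w * sin a ^ 2 <= w * sin t).
    { apply Rmult_le_compat_l; [lra | nra]. }
    apply Rmult_le_compat; [apply Rabs_pos | | |].
    - apply Rlt_le, Rinv_0_lt_compat, Rmult_lt_0_compat; lra.
    - apply Rabs_le; pose proof (COS_bound (w * t)); lra.
    - apply Rinv_le_contravar; [|lra].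
      apply Rmult_lt_0_compat; [lra | apply pow_lt; lra]. }
  replace ((PI + 2) / sin a ^ 2 / w)
    with (PI / (w * sin a ^ 2) + 2 / (w * sin a ^ 2)) by (field; lra).
  eapply Rle_trans; [apply Rabs_triang|].
  rewrite Rabs_Ropp; lra.
Qed.

Lemma ex_parabola_series t :
  ex_series (fun k => (1 - cos (2 * INR (S k) * t)) * inv_sq k).
Proof.
  apply ex_series_bounded_inv_sq with 2; intros k.
  apply Rabs_le; pose proof (COS_bound (2 * INR (S k) * t)); lra.
Qed.

Definition parabola_series (t : R) : R :=
  Series (fun k => (1 - cos (2 * INR (S k) * t)) * inv_sq k).

Lemma parabola_sum_bounds K t :
  0 <= parabola_series t - parabola_sum K t <= 2 * inv_sq_tail K.
Proof.
  apply (partial_sum_bounds (fun k => 1 - cos (2 * INR (S k) * t)) 2).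
  - intros k; apply one_minus_cos_range.
  - apply Series_correct, ex_parabola_series.
Qed.

Definition parabola_gap (t : R) : R := parabola_series t - t * (PI - t).

(** The derivatives of the partial sums converge to the one of the parabola
    uniformly on [[a, PI / 2]]. *)
Lemma parabola_gap_constant a :
  0 < a <= PI / 2 -> parabola_gap a = parabola_gap (PI / 2).
Proof.
  intros Ha; pose proof PI_RGT_0 as HPI.
  set (d := fun K t => parabola_sum K t - t * (PI - t)).
  assert (L : forall t, is_lim_seq (fun K => d K t) (parabola_gap t)).
  { intros t; apply is_lim_seq_minus'; [|apply is_lim_seq_const].
    exact (Series_correct _ (ex_parabola_series t)). }
  assert (L1 : is_lim_seq (fun K => d K (PI / 2) - d K a)
                 (parabola_gap (PI / 2) - parabola_gap a))
    by (apply is_lim_seq_minus'; apply L).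
  assert (L2 : is_lim_seq (fun K => d K (PI / 2) - d K a) 0).
  { set (C := (PI + 2) / sin a ^ 2).
    apply is_lim_seq_squeeze0
      with (fun K => (C * (PI / 2 - a)) / (2 * INR K + 3)).
    2: apply is_lim_seq_inv_linear; lra.
    intros K; rewrite Rminus_0_r.
    assert (Hs : 0 < sin a) by (apply sin_gt_0; lra).
    replace (C * (PI / 2 - a) / (2 * INR K + 3))
      with (C / (2 * INR K + 3) * (PI / 2 - a))
      by (unfold Rdiv; ring).
    apply mean_value_bound with (sawtooth_defect K); try lra.
    - unfold C; pose proof (pos_INR K).
      apply Rmult_le_pos; [apply Rmult_le_pos; [lra|] |];
        apply Rlt_le, Rinv_0_lt_compat; [apply pow_lt |]; lra.
    - intros; apply is_derive_parabola_defect.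
    - intros; eapply is_derive_continuity_pt, is_derive_parabola_defect.
    - intros x Hx; apply sawtooth_defect_bound; lra. }
  pose proof (is_lim_seq_unique _ _ L1) as E1.
  rewrite (is_lim_seq_unique _ _ L2) in E1; injection E1; lra.
Qed.

(** Near the origin both the series and the parabola vanish, the series
    because its tails are uniformly small. *)
Lemma parabola_gap_zero : parabola_gap (PI / 2) = 0.
Proof.
  pose proof PI_RGT_0 as HPI.
  assert (Hq : forall k, inv_sq k * INR (S k) ^ 2 = 1).
  { intros k; unfold inv_sq; pose proof (INR_S_pos k); field; lra. }
  assert (Hsmall : forall K t, 0 <= parabola_sum K t <= INR (S K) * (2 * t ^ 2)).
  { intros K t; induction K as [|K IH]; unfold parabola_sum in *;
      [rewrite sum_O | rewrite sum_n_succ].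
    - pose proof (one_minus_cos_le_sq (2 * INR 1 * t)).
      pose proof (one_minus_cos_range (2 * INR 1 * t)).
      unfold inv_sq; simpl in *; lra.
    - pose proof (one_minus_cos_le_sq (2 * INR (S (S K)) * t)) as H1.
      pose proof (one_minus_cos_range (2 * INR (S (S K)) * t)) as H2.
      pose proof (inv_sq_pos (S K)) as H3; pose proof (Hq (S K)) as H4.
      replace (INR (S (S K)) * (2 * t ^ 2)) with (INR (S K) * (2 * t ^ 2) + 2 * t ^ 2)
        by (rewrite (S_INR (S K)); ring).
      set (c := 1 - cos _) in *; set (q := inv_sq (S K)) in *.
      assert (0 <= c * q <= 2 * t ^ 2).
      { split; [nra|].
        replace (2 * t ^ 2) with ((2 * INR (S (S K)) * t) ^ 2 / 2 * q).
        - apply Rmult_le_compat_r; lra.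
        - replace ((2 * INR (S (S K)) * t) ^ 2 / 2 * q)
            with (2 * t ^ 2 * (q * INR (S (S K)) ^ 2)) by field.
          rewrite H4; ring. }
      lra. }
  assert (Hb : forall K, Rabs (parabola_gap (PI / 2)) <= 2 * inv_sq_tail K).
  { intros K; apply le_epsilon; intros eps Heps.
    (* For [t <= PI / 2], the partial sum of order [K] and the parabola add up
       to at most [t * M]. *)
    set (M := INR (S K) * 2 * PI + PI).
    assert (HM : 0 < M) by (unfold M; pose proof (INR_S_pos K); nra).
    set (t := Rmin (PI / 2) (eps / M)).
    assert (Ht : 0 < t <= PI / 2).
    { split; [|apply Rmin_l].
      apply Rmin_glb_lt; [lra | now apply Rdiv_lt_0_compat]. }
    assert (HtM : t * M <= eps).
    { apply Rle_trans with (eps / M * M).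
      - apply Rmult_le_compat_r; [lra | apply Rmin_r].
      - right; field; lra. }
    rewrite <- (parabola_gap_constant t) by lra; unfold parabola_gap.
    pose proof (parabola_sum_bounds K t) as H1.
    pose proof (Hsmall K t) as H2; pose proof (INR_S_pos K) as H3.
    assert (INR (S K) * (2 * t ^ 2) <= t * (INR (S K) * 2 * PI)).
    { replace (INR (S K) * (2 * t ^ 2)) with (t * (INR (S K) * 2 * t)) by ring.
      apply Rmult_le_compat_l; [lra|]; apply Rmult_le_compat_l; lra. }
    assert (0 <= t * (PI - t) <= t * PI) by nra.
    unfold M in HtM; apply Rabs_le; nra. }
  assert (H := is_lim_seq_le _ _ _ _ Hb (is_lim_seq_const _)
                 (is_lim_seq_mult' _ _ _ _ (is_lim_seq_const 2) inv_sq_tail_lim)).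
  simpl in H; rewrite Rmult_0_r in H.
  pose proof (Rabs_pos (parabola_gap (PI / 2))) as H0.
  destruct (Req_dec (parabola_gap (PI / 2)) 0) as [E|E]; [exact E|].
  apply Rabs_pos_lt in E; lra.
Qed.

(** The parabola is extended to each interval between consecutive multiples
    of [PI] by periodicity of the cosines, and from the left half of the period
    to the right half by symmetry. *)
Lemma parabola_series_eq j t :
  INR j * PI <= t <= INR (S j) * PI ->
  parabola_series t = (t - INR j * PI) * (INR (S j) * PI - t).
Proof.
  pose proof PI_RGT_0 as HPI; rewrite S_INR; intros Ht.
  assert (Hhalf : forall x, 0 <= x <= PI / 2 -> parabola_series x = x * (PI - x)).
  { intros x Hx; destruct (Req_dec x 0) as [->|Hx0].
    - rewrite Rmult_0_l; unfold parabola_series.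
      rewrite (Series_ext _ (fun k => 0 * inv_sq k)).
      + rewrite Series_scal_l; ring.
      + intros k; rewrite Rmult_0_r, cos_0; ring.
    - pose proof (parabola_gap_constant x ltac:(lra)) as H.
      rewrite parabola_gap_zero in H; unfold parabola_gap in H; lra. }
  set (x := t - INR j * PI).
  assert (Hper : parabola_series t = parabola_series x).
  { apply Series_ext; intros k; do 2 f_equal.
    replace (2 * INR (S k) * t)
      with (2 * INR (S k) * x + 2 * INR (S k * j) * PI)
      by (rewrite mult_INR; unfold x; ring).
    apply cos_period. }
  rewrite Hper; replace ((INR j + 1) * PI - t) with (PI - x) by (unfold x; ring).
  assert (Hx : 0 <= x <= PI) by (unfold x; lra).
  destruct (Rle_dec x (PI / 2)) as [H|H]; [apply Hhalf; lra|].
  replace (parabola_series x) with (parabola_series (PI - x)).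
  - rewrite Hhalf by lra; ring.
  - apply Series_ext; intros k; do 2 f_equal.
    replace (2 * INR (S k) * (PI - x))
      with (- (2 * INR (S k) * x) + 2 * INR (S k) * PI) by ring.
    rewrite cos_period; apply cos_neg.
Qed.

(** * The Basel sum *)

(** Only odd indices survive; the even ones are subtracted from the full sum.
    This serves for the inverse squares and for the harmonic numbers. *)
Lemma sum_even_vanish (c : nat -> R) n :
  sum_n (fun k => (1 - cos (INR (S k) * PI)) * c (S k)) (S (2 * n)) =
  2 * (sum_n (fun k => c (S k)) (S (2 * n))
       - sum_n (fun k => c (2 * S k)%nat) n) :> R.
Proof.
  assert (Hodd : forall m, cos (INR (S (2 * m)) * PI) = -1).
  { intros m; rewrite S_INR, mult_INR.
    replace ((INR 2 * INR m + 1) * PI) with (PI + 2 * INR m * PI) by (simpl; ring).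
    rewrite cos_period; apply cos_PI. }
  assert (Heven : forall m, cos (INR (2 * m) * PI) = 1).
  { intros m; rewrite mult_INR.
    replace (INR 2 * INR m * PI) with (0 + 2 * INR m * PI) by (simpl; ring).
    rewrite cos_period; apply cos_0. }
  induction n as [|n IH].
  - change (S (2 * 0)) with 1%nat; rewrite !sum_n_succ, !sum_O.
    pose proof (Hodd 0%nat) as H1; pose proof (Heven 1%nat) as H2.
    change (S (2 * 0)) with 1%nat in H1; change (2 * 1)%nat with 2%nat in *.
    rewrite H1, H2; ring.
  - replace (S (2 * S n)) with (S (S (S (2 * n)))) by lia.
    rewrite !(sum_n_succ _ (S (S (2 * n)))), !(sum_n_succ _ (S (2 * n))), IH.
    rewrite (sum_n_succ _ n).
    replace (S (S (S (2 * n)))) with (S (2 * S n)) by lia.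
    replace (S (S (2 * n))) with (2 * S n)%nat by lia.
    rewrite Hodd.
    replace (S (S (2 * S n))) with (2 * S (S n))%nat by lia.
    replace (S (2 * S n)) with (S (2 * (S n)))%nat by lia.
    rewrite !Heven; ring.
Qed.

Lemma basel : Series inv_sq = PI ^ 2 / 6.
Proof.
  pose proof PI_RGT_0 as HPI.
  set (Z := Series inv_sq).
  assert (HZ : is_lim_seq (sum_n inv_sq) Z)
    by exact (Series_correct _ ex_series_inv_sq).
  assert (Hsub : filterlim (fun n => S (2 * n)) eventually eventually).
  { apply eventually_subseq; intros n; lia. }
  assert (L1 : is_lim_seq (fun n => parabola_sum (S (2 * n)) (PI / 2))
                 (PI ^ 2 / 4)).
  { apply (is_lim_seq_subseq (fun K => parabola_sum K (PI / 2))); [exact Hsub|].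
    replace (PI ^ 2 / 4) with (parabola_series (PI / 2)).
    - exact (Series_correct _ (ex_parabola_series (PI / 2))).
    - rewrite (parabola_series_eq 0) by (simpl; lra). simpl; field. }
  assert (L2 : is_lim_seq (fun n => parabola_sum (S (2 * n)) (PI / 2))
                 (2 * (Z - / 4 * Z))).
  { apply is_lim_seq_ext with
      (fun n => 2 * (sum_n inv_sq (S (2 * n)) - / 4 * sum_n inv_sq n)).
    - intros n; rewrite <- sum_n_scal; unfold inv_sq, parabola_sum.
      rewrite (sum_n_ext (fun k => / 4 * / INR (S k) ^ 2)
                 (fun k => (fun m => / INR m ^ 2) (2 * S k)%nat)).
      + rewrite <- (sum_even_vanish (fun m => / INR m ^ 2)).
        apply sum_n_ext; intros k.
        replace (2 * INR (S k) * (PI / 2)) with (INR (S k) * PI) by field.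
        reflexivity.
      + intros k; change (/ 4 * / INR (S k) ^ 2 = / INR (2 * S k) ^ 2 :> R).
        rewrite mult_INR; pose proof (INR_S_pos k).
        replace (INR 2) with 2 by reflexivity; field; lra.
    - apply is_lim_seq_mult'; [apply is_lim_seq_const|].
      apply is_lim_seq_minus'; [now apply (is_lim_seq_subseq (sum_n inv_sq))|].
      apply is_lim_seq_mult'; [apply is_lim_seq_const | exact HZ]. }
  pose proof (is_lim_seq_unique _ _ L1) as E1.
  rewrite (is_lim_seq_unique _ _ L2) in E1; injection E1; lra.
Qed.
Lemma is_lim_seq_approx (u : nat -> R) (l : R) :
  (forall eps, 0 < eps -> exists v, is_lim_seq v 0 /\
     forall n, Rabs (u n - l) <= eps + v n) ->
  is_lim_seq u l.
Proof.
  intros H; apply is_lim_seq_Reals; intros eps Heps.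
  destruct (H (eps / 2)) as [v [Hv Hb]]; [lra|].
  apply is_lim_seq_Reals in Hv; destruct (Hv (eps / 2)) as [N HN]; [lra|].
  exists N; intros n Hn; specialize (HN n Hn); specialize (Hb n).
  unfold R_dist in *; rewrite Rminus_0_r in HN.
  apply Rabs_def2 in HN; lra.
Qed.

(** * The cosine integral *)

(** Total division makes the value at [0] equal to [0], which is also the limit
    there. *)
Definition cin_kernel (s : R) : R := (1 - cos s) / s.

Definition cin (y : R) : R := RInt cin_kernel 0 y.

Lemma cin_kernel_continuous s : continuous cin_kernel s.
Proof.
  destruct (Req_dec s 0) as [->|Hs].
  - apply (proj2 (filterlim_locally cin_kernel (cin_kernel 0))).
    intros eps; exists eps; intros y Hy.
    change (Rabs (y - 0) < eps) in Hy.
    change (Rabs (cin_kernel y - cin_kernel 0) < eps).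
    rewrite Rminus_0_r in Hy; unfold cin_kernel.
    rewrite cos_0, Rminus_diag; unfold Rdiv; rewrite Rmult_0_l, Rminus_0_r.
    destruct (Req_dec y 0) as [->|Hy0].
    + rewrite cos_0, Rminus_diag, Rmult_0_l, Rabs_R0; apply eps.
    + apply Rabs_pos_lt in Hy0.
      rewrite Rabs_mult, Rabs_inv, Rabs_pos_eq by apply one_minus_cos_range.
      apply Rle_lt_trans with (Rabs y / 2); [|lra].
      replace (Rabs y / 2) with (Rabs y ^ 2 / 2 * / Rabs y) by (field; lra).
      apply Rmult_le_compat_r; [apply Rlt_le, Rinv_0_lt_compat; lra|].
      rewrite pow2_abs; apply one_minus_cos_le_sq.
  - apply (ex_derive_continuous cin_kernel s); unfold cin_kernel.
    auto_derive; exact Hs.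
Qed.

Lemma is_derive_cin y : is_derive cin y (cin_kernel y).
Proof.
  apply (is_derive_RInt cin_kernel cin 0 y); [|apply cin_kernel_continuous].
  apply filter_forall; intros b; apply (RInt_correct cin_kernel).
  apply (ex_RInt_continuous cin_kernel); intros; apply cin_kernel_continuous.
Qed.

Lemma cin_0 : cin 0 = 0.
Proof. exact (RInt_point 0 cin_kernel). Qed.

Lemma is_derive_cin_scaled c t :
  0 < c -> is_derive (fun x => cin (c * x)) t ((1 - cos (c * t)) / t).
Proof.
  intros Hc.
  replace ((1 - cos (c * t)) / t) with (c * cin_kernel (c * t)).
  - apply (is_derive_comp cin (fun x => c * x)); [apply is_derive_cin|].
    auto_derive; [trivial | ring].
  - unfold cin_kernel; destruct (Req_dec t 0) as [->|Ht].
    + rewrite Rmult_0_r, cos_0, Rminus_diag; unfold Rdiv; ring.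
    + field; lra.
Qed.

Definition cin_sum (K : nat) (t : R) : R :=
  sum_n (fun k => cin (2 * INR (S k) * t) * inv_sq k) K.

Lemma is_derive_cin_sum K t : is_derive (cin_sum K) t (parabola_sum K t / t).
Proof.
  replace (parabola_sum K t / t)
    with (sum_n (fun k => (1 - cos (2 * INR (S k) * t)) / t * inv_sq k) K : R).
  - apply (is_derive_sum_n (fun k x => cin (2 * INR (S k) * x) * inv_sq k)).
    intros k _.
    apply (is_derive_ext (fun x => inv_sq k * cin (2 * INR (S k) * x)));
      [intros; apply Rmult_comm|].
    rewrite (Rmult_comm _ (inv_sq k)).
    apply (is_derive_scal (fun x => cin (2 * INR (S k) * x))).
    apply is_derive_cin_scaled; pose proof (INR_S_pos k); lra.
  - unfold Rdiv; rewrite Rmult_comm; unfold parabola_sum.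
    rewrite <- sum_n_scal; apply sum_n_ext; intros k.
    change ((1 - cos (2 * INR (S k) * t)) * / t * inv_sq k =
            / t * ((1 - cos (2 * INR (S k) * t)) * inv_sq k)); ring.
Qed.

(** The derivative of [cin_sum K - Q] is [- 1 / t] times a tail of the Fourier
    series of the parabola. The tails are uniformly small, which suffices away
    from [t = 0]; they are also at most the parabola itself, whose quotient by [t]
    is bounded by [PI]. The second bound is used on a short interval at the left
    endpoint, which is [0] when [j = 0]. *)
Lemma cin_sum_increment_lim (j : nat) (Q : R -> R) :
  let a := INR j * PI in let b := INR (S j) * PI in
  (forall t, a < t < b -> is_derive Q t ((t - a) * (b - t) / t)) ->
  (forall t, a <= t <= b -> continuity_pt Q t) ->
  is_lim_seq (fun K => cin_sum K b - cin_sum K a) (Q b - Q a).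
Proof.
  intros a b HQ HcQ; pose proof PI_RGT_0 as HPI.
  assert (Ha : 0 <= a) by (apply Rmult_le_pos; [apply pos_INR | lra]).
  assert (Hb : b = a + PI) by (unfold a, b; rewrite S_INR; ring).
  set (f := fun K t => cin_sum K t - Q t).
  set (df := fun K t => parabola_sum K t / t - (t - a) * (b - t) / t).
  assert (Hd : forall K t, a < t < b -> is_derive (f K) t (df K t)).
  { intros K t Ht; apply (is_derive_minus (cin_sum K) Q);
      [apply is_derive_cin_sum | now apply HQ]. }
  assert (Hc : forall K t, a <= t <= b -> continuity_pt (f K) t).
  { intros K t Ht; apply continuity_pt_minus; [|now apply HcQ].
    eapply is_derive_continuity_pt, is_derive_cin_sum. }
  assert (Hdf : forall K t, a < t < b ->
            0 <= - df K t * t <= 2 * inv_sq_tail K /\ - df K t * t <= t * PI).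
  { intros K t Ht; unfold df.
    assert (Hp : parabola_series t = (t - a) * (b - t))
      by (apply parabola_series_eq; fold a b; lra).
    pose proof (parabola_sum_bounds K t) as H.
    replace (- (parabola_sum K t / t - (t - a) * (b - t) / t) * t)
      with (parabola_series t - parabola_sum K t)
      by (rewrite Hp; field; lra).
    split; [exact H|]; rewrite Hp.
    assert (0 <= parabola_sum K t).
    { unfold parabola_sum; rewrite <- (sum_n_zero (fun _ => 0) K) by reflexivity.
      apply sum_n_le; intros k; apply Rmult_le_pos;
        [apply one_minus_cos_range | apply Rlt_le, inv_sq_pos]. }
    enough ((t - a) * (b - t) <= t * PI) by lra.
    apply Rmult_le_compat; lra. }
  apply is_lim_seq_approx; intros eps Heps.
  set (e := Rmin (PI / 2) (eps / PI)).
  assert (He : 0 < e <= PI / 2).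
  { split; [|apply Rmin_l].
    apply Rmin_glb_lt; [lra | now apply Rdiv_lt_0_compat]. }
  assert (HeP : PI * e <= eps).
  { apply Rle_trans with (PI * (eps / PI)).
    - apply Rmult_le_compat_l; [lra | apply Rmin_r].
    - right; field; lra. }
  exists (fun K => 2 * PI / e * inv_sq_tail K); split.
  { replace (Finite 0) with (Finite (2 * PI / e * 0)) by (f_equal; ring).
    apply is_lim_seq_mult'; [apply is_lim_seq_const | apply inv_sq_tail_lim]. }
  intros K.
  replace (cin_sum K b - cin_sum K a - (Q b - Q a))
    with ((f K (a + e) - f K a) + (f K b - f K (a + e))) by (unfold f; ring).
  assert (Htail : 0 <= inv_sq_tail K).
  { destruct (Hdf K (a + e) ltac:(lra)) as [H _]; lra. }
  assert (H1 : Rabs (f K (a + e) - f K a) <= PI * (a + e - a)).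
  { apply mean_value_bound with (df K); try lra.
    - intros t Ht; apply Hd; lra.
    - intros t Ht; apply Hc; lra.
    - intros t Ht; destruct (Hdf K t ltac:(lra)) as [[H _] H'].
      rewrite Rabs_left1 by nra; apply Rmult_le_reg_r with t; lra. }
  assert (H2 : Rabs (f K b - f K (a + e))
               <= 2 * inv_sq_tail K / e * (b - (a + e))).
  { apply mean_value_bound with (df K); try lra.
    - apply Rmult_le_pos; [lra | apply Rlt_le, Rinv_0_lt_compat; lra].
    - intros t Ht; apply Hd; lra.
    - intros t Ht; apply Hc; lra.
    - intros t Ht; destruct (Hdf K t ltac:(lra)) as [[H H''] _].
      rewrite Rabs_left1 by nra.
      apply Rmult_le_reg_r with t; [lra|].
      apply Rle_trans with (2 * inv_sq_tail K); [exact H''|].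
      apply Rle_trans with (2 * inv_sq_tail K / e * e); [right; field; lra|].
      apply Rmult_le_compat_l; [|lra].
      apply Rmult_le_pos; [lra | apply Rlt_le, Rinv_0_lt_compat; lra]. }
  assert (H3 : 2 * inv_sq_tail K / e * (b - (a + e)) <= 2 * PI / e * inv_sq_tail K).
  { replace (2 * PI / e * inv_sq_tail K) with (2 * inv_sq_tail K / e * PI)
      by (field; lra).
    apply Rmult_le_compat_l; [|lra].
    apply Rmult_le_pos; [lra | apply Rlt_le, Rinv_0_lt_compat; lra]. }
  eapply Rle_trans; [apply Rabs_triang|].
  replace (a + e - a) with e in H1 by ring; lra.
Qed.

Lemma cin_sum_period_lim (j : nat) :
  is_lim_seq (fun K => cin_sum K (INR (S j) * PI) - cin_sum K (INR j * PI))
    (PI ^ 2 * ((2 * INR j + 1) / 2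
               - INR j * (INR j + 1) * (ln (INR (S j)) - ln (INR j)))).
Proof.
  pose proof PI_RGT_0 as HPI; destruct j as [|j].
  - pose (Q := fun t => - t ^ 2 / 2 + PI * t).
    assert (HQ : forall t, is_derive Q t (PI - t))
      by (intros t; unfold Q; auto_derive; [trivial | field]).
    replace (PI ^ 2 * _) with (Q (INR 1 * PI) - Q (INR 0 * PI))
      by (unfold Q; simpl; field).
    apply cin_sum_increment_lim.
    + intros t Ht; simpl in Ht; replace (_ / t) with (PI - t); [apply HQ|].
      simpl; field; lra.
    + intros t _; eapply is_derive_continuity_pt, HQ.
  - set (x := INR (S j)); assert (Hx : 0 < x) by apply INR_S_pos.
    pose (Q := fun t => - t ^ 2 / 2 + (2 * x + 1) * PI * t
                        - x * (x + 1) * PI ^ 2 * ln t).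
    assert (HQ : forall t, 0 < t ->
               is_derive Q t ((t - x * PI) * ((x + 1) * PI - t) / t))
      by (intros t Ht; unfold Q; auto_derive; [exact Ht | field; lra]).
    replace (PI ^ 2 * _) with (Q (INR (S (S j)) * PI) - Q (x * PI)).
    + assert (0 < x * PI) by (apply Rmult_lt_0_compat; lra).
      apply (cin_sum_increment_lim (S j)); fold x.
      * intros t Ht; rewrite (S_INR (S j)); fold x; apply HQ; lra.
      * intros t Ht; eapply is_derive_continuity_pt, HQ; lra.
    + unfold Q; rewrite (S_INR (S j)); fold x.
      rewrite !ln_mult by lra; field.
Qed.

(** If [A_N] is the quotient whose limit is the Glaisher-Kinkelin constant, this
    is [2 ln A_N + ln N / 6]. *)
Definition glaisher_log (N : nat) : R :=
  INR N ^ 2 / 2 - (INR N ^ 2 + INR N) * ln (INR N)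
  + 2 * sum_n (fun k => INR k * ln (INR k)) N.

(** Over the successive periods the logarithms collect, by summation by parts,
    into the logarithm of the hyperfactorial. *)
Lemma cin_sum_lim (N : nat) :
  is_lim_seq (fun K => cin_sum K (INR N * PI)) (PI ^ 2 * glaisher_log N).
Proof.
  induction N as [|N IH].
  - apply is_lim_seq_ext with (fun _ => 0).
    + intros K; unfold cin_sum; rewrite sum_n_zero; [reflexivity|].
      intros k; simpl (INR 0); rewrite Rmult_0_l, Rmult_0_r, cin_0; ring.
    + replace (PI ^ 2 * glaisher_log 0) with 0; [apply is_lim_seq_const|].
      unfold glaisher_log; rewrite sum_O; simpl; field.
  - apply is_lim_seq_ext with
      (fun K => cin_sum K (INR N * PI)
                + (cin_sum K (INR (S N) * PI) - cin_sum K (INR N * PI)));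
      [intros; ring|].
    replace (PI ^ 2 * glaisher_log (S N)) with
      (PI ^ 2 * glaisher_log N
       + PI ^ 2 * ((2 * INR N + 1) / 2
                   - INR N * (INR N + 1) * (ln (INR (S N)) - ln (INR N)))).
    + apply is_lim_seq_plus'; [exact IH | apply cin_sum_period_lim].
    + unfold glaisher_log; rewrite sum_n_succ.
      generalize (ln (INR (S N))); intros y; rewrite S_INR; field.
Qed.

(** * The constant term of the cosine integral *)

Lemma harmonic_lim :
  is_lim_seq (fun n => sum_n (fun k => / INR (S k)) n - ln (INR (S n)))
    euler_gamma.
Proof.
  set (h := fun n => sum_n (fun k => / INR (S k)) n - ln (INR (S n))).
  assert (Hln : forall x, 0 < x -> / (x + 1) <= ln (x + 1) - ln x <= / x).
  { intros x Hx.
    assert (Hexp : forall y, 0 < y -> ln y <= y - 1).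
    { intros y Hy; pose proof (exp_ineq1_le (ln y)) as H.
      rewrite exp_ln in H; lra. }
    pose proof (Hexp ((x + 1) / x) ltac:(apply Rdiv_lt_0_compat; lra)) as H1.
    pose proof (Hexp (x / (x + 1)) ltac:(apply Rdiv_lt_0_compat; lra)) as H2.
    rewrite ln_div in H1, H2 by lra.
    replace ((x + 1) / x - 1) with (/ x) in H1 by (field; lra).
    replace (x / (x + 1) - 1) with (- / (x + 1)) in H2 by (field; lra).
    lra. }
  destruct (ex_finite_lim_seq_decr h 0) as [l Hl].
  - intros n; unfold h; rewrite sum_n_succ, (S_INR (S n)).
    pose proof (Hln _ (INR_S_pos n)); lra.
  - intros n.
    enough (/ INR (S n) <= h n)
      by (pose proof (Rinv_0_lt_compat _ (INR_S_pos n)); lra).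
    induction n as [|n IH]; unfold h in *.
    + rewrite sum_O; simpl; rewrite ln_1; lra.
    + rewrite sum_n_succ, (S_INR (S n)).
      pose proof (Hln _ (INR_S_pos n)); lra.
  - replace euler_gamma with l; [exact Hl|].
    unfold euler_gamma; rewrite (is_lim_seq_unique _ l); [reflexivity|].
    apply is_lim_seq_incr_1; revert Hl; apply is_lim_seq_ext; intros n.
    unfold h; f_equal; exact (sum_n_m_S (fun k => / INR k) 0 n).
Qed.

(** The conjugate Dirichlet kernel. *)
Lemma cot_kernel p t :
  sin t * (2 * sum_n (fun k => sin (2 * INR (S k) * t)) p
           - sin (2 * INR (S p) * t)) =
  cos t * (1 - cos (2 * INR (S p) * t)).
Proof.
  induction p as [|p IH].
  - rewrite sum_O; replace (2 * INR 1 * t) with (2 * t) by (simpl; ring).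
    rewrite sin_2a, cos_2a_sin; ring.
  - rewrite sum_n_succ; set (s := sum_n _ p) in *.
    set (al := (2 * INR (S p) + 1) * t).
    replace (2 * INR (S (S p)) * t) with (al + t)
      by (rewrite (S_INR (S p)); unfold al; ring).
    replace (2 * INR (S p) * t) with (al - t) in IH by (unfold al; ring).
    rewrite sin_plus, cos_plus; rewrite sin_minus, cos_minus in IH.
    lra.
Qed.

(** The second term is the integral of [(1 - cos (2 n x)) * cot x] from [0] to
    [t], for [n = p + 1], by [cot_kernel]. *)
Definition cot_defect (p : nat) (t : R) : R :=
  cin (2 * INR (S p) * t)
  - (sum_n (fun k => (1 - cos (2 * INR (S k) * t)) / INR (S k)) p
     - (1 - cos (2 * INR (S p) * t)) / (2 * INR (S p))).

Lemma is_derive_cot_defect p t :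
  is_derive (cot_defect p) t
    ((1 - cos (2 * INR (S p) * t)) / t
     - (2 * sum_n (fun k => sin (2 * INR (S k) * t)) p
        - sin (2 * INR (S p) * t))).
Proof.
  apply (is_derive_minus (fun x => cin (2 * INR (S p) * x))
    (fun x => sum_n (fun k => (1 - cos (2 * INR (S k) * x)) / INR (S k)) p
     - (1 - cos (2 * INR (S p) * x)) / (2 * INR (S p)))).
  { apply is_derive_cin_scaled; pose proof (INR_S_pos p); lra. }
  apply (is_derive_minus
    (fun x => sum_n (fun k => (1 - cos (2 * INR (S k) * x)) / INR (S k)) p)
    (fun x => (1 - cos (2 * INR (S p) * x)) / (2 * INR (S p)))).
  - rewrite <- sum_n_scal.
    apply (is_derive_sum_n (fun k x => (1 - cos (2 * INR (S k) * x)) / INR (S k))).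
    intros k _; generalize (INR (S k)) (INR_S_pos k); intros c Hc.
    auto_derive; [trivial | field; lra].
  - generalize (INR (S p)) (INR_S_pos p); intros c Hc.
    auto_derive; [trivial | field; lra].
Qed.

Definition cot_gap (t : R) : R := / t - cos t / sin t.

Lemma sin_bounds t : 0 < t <= PI / 2 -> t * cos t <= sin t < t.
Proof.
  intros Ht; pose proof PI_RGT_0; split; [|apply sin_lt_x; lra].
  destruct (MVT_gen (fun x => sin x - x * cos x) 0 t (fun x => x * sin x))
    as [c [Hc E]].
  - intros x _; auto_derive; [trivial | ring].
  - intros x _; eapply is_derive_continuity_pt.
    auto_derive; [trivial | reflexivity].
  - rewrite Rmin_left, Rmax_right in Hc by lra.
    rewrite sin_0, Rmult_0_l in E.
    assert (0 <= sin c) by (apply sin_ge_0; lra).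
    assert (0 <= c * sin c * (t - 0)).
    { apply Rmult_le_pos; [apply Rmult_le_pos|]; lra. }
    lra.
Qed.

Lemma cot_gap_range t : 0 < t <= PI / 2 -> 0 <= cot_gap t <= 1.
Proof.
  intros Ht; pose proof PI_RGT_0; pose proof (sin_bounds t Ht) as Hb.
  assert (Hs : 0 < sin t) by (apply sin_gt_0; lra).
  assert (Hc : 0 <= cos t) by (apply cos_ge_0; lra).
  assert (Hts : 0 < t * sin t) by (apply Rmult_lt_0_compat; lra).
  unfold cot_gap; replace (/ t - cos t / sin t)
    with ((sin t - t * cos t) / (t * sin t)) by (field; lra).
  split.
  - apply Rmult_le_pos; [lra | apply Rlt_le, Rinv_0_lt_compat; lra].
  - apply Rmult_le_reg_r with (t * sin t); [lra|].
    replace ((sin t - t * cos t) / (t * sin t) * (t * sin t))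
      with (sin t - t * cos t) by (field; lra).
    pose proof (sin2_cos2 t) as E; unfold Rsqr in E.
    pose proof (COS_bound t); pose proof (SIN_bound t).
    assert (1 <= sin t + cos t) by nra.
    nra.
Qed.

(** [ln t - ln (sin t)] is the antiderivative of [cot_gap] that vanishes at
    the origin. *)
Lemma ln_sinc_small t : 0 < t <= 1 -> 0 <= ln t - ln (sin t) <= t.
Proof.
  intros Ht; pose proof PI2_1 as HPI; pose proof (sin_bounds t ltac:(lra)) as Hb.
  assert (Hs : 0 < sin t) by (apply sin_gt_0; lra).
  split.
  - enough (ln (sin t) <= ln t) by lra; apply ln_le; lra.
  - rewrite <- ln_div by lra.
    assert (Hr : 0 < t / sin t) by (apply Rdiv_lt_0_compat; lra).
    pose proof (exp_ineq1_le (ln (t / sin t))) as H; rewrite exp_ln in H by lra.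
    enough (t / sin t <= 1 + t) by lra.
    apply Rmult_le_reg_r with (sin t); [lra|].
    replace (t / sin t * sin t) with t by (field; lra).
    pose proof (one_minus_cos_le_sq t).
    assert (t - t ^ 3 / 2 <= sin t) by nra.
    assert (0 <= (1 + t) * (t - t ^ 3 / 2) - t) by nra.
    nra.
Qed.

(** Replacing [1 / t] by [cot t] turns the cosine integral into a finite sum.
    The price is the integral of [(1 - cos (2 n t)) * cot_gap t]. The part without
    cosine is [ln (PI / 2)], and the oscillating part tends to [0]; this is made quantitative on
    [[e, PI / 2]] by the same correction as for the sawtooth. *)
Lemma cot_defect_lim :
  is_lim_seq (fun p => cot_defect p (PI / 2)) (ln (PI / 2)).
Proof.
  pose proof PI_RGT_0 as HPI; pose proof PI2_1 as HPI1.
  apply is_lim_seq_approx; intros eps Heps.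
  set (e := Rmin 1 (eps / 3)).
  assert (He : 0 < e <= 1) by (split; [apply Rmin_glb_lt; lra | apply Rmin_l]).
  assert (He3 : 3 * e <= eps) by (pose proof (Rmin_r 1 (eps / 3)) as H; fold e in H; lra).
  assert (Hse : 0 < sin e) by (apply sin_gt_0; lra).
  set (C := / sin e ^ 2 * (PI / 2) + 1).
  exists (fun p => C / (2 * INR p + 2)); split;
    [apply is_lim_seq_inv_linear; lra|].
  intros p; set (w := 2 * INR (S p)).
  assert (Hw : 0 < w) by (unfold w; pose proof (INR_S_pos p); lra).
  replace (2 * INR p + 2) with w by (unfold w; rewrite S_INR; ring).
  set (dV := fun t => (1 - cos (w * t)) * cot_gap t).
  assert (HV : forall t, 0 < t <= PI / 2 -> is_derive (cot_defect p) t (dV t)).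
  { intros t Ht; assert (Hs : 0 < sin t) by (apply sin_gt_0; lra).
    replace (dV t) with ((1 - cos (w * t)) / t
      - (2 * sum_n (fun k => sin (2 * INR (S k) * t)) p - sin (w * t)));
      [apply is_derive_cot_defect|].
    pose proof (cot_kernel p t) as E; fold w in E.
    unfold dV, cot_gap; set (s := 2 * sum_n _ p - _) in *.
    replace s with (sin t * s / sin t) by (field; lra).
    rewrite E; field; lra. }
  assert (H1 : Rabs (cot_defect p e) <= 2 * e).
  { assert (H0 : cot_defect p 0 = 0).
    { unfold cot_defect; rewrite sum_n_zero.
      - rewrite !Rmult_0_r, cin_0, cos_0; unfold Rdiv; ring.
      - intros k; rewrite Rmult_0_r, cos_0; unfold Rdiv; ring. }
    rewrite <- (Rminus_0_r (cot_defect p e)), <- H0.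
    replace (2 * e) with (2 * (e - 0)) by ring.
    apply mean_value_bound with dV; try lra.
    - intros t Ht; apply HV; lra.
    - intros t _; eapply is_derive_continuity_pt, is_derive_cot_defect.
    - intros t Ht; unfold dV.
      pose proof (cot_gap_range t ltac:(lra)).
      pose proof (one_minus_cos_range (w * t)).
      rewrite Rabs_pos_eq by nra; nra. }
  pose (W := fun t => cot_defect p t
                      + (sin (w * t) * cot_gap t / w - (ln t - ln (sin t)))).
  pose (dW := fun t => sin (w * t) * (/ sin t ^ 2 - / t ^ 2) / w).
  assert (HW : forall t, e <= t <= PI / 2 -> is_derive W t (dW t)).
  { intros t Ht; assert (Hs : 0 < sin t) by (apply sin_gt_0; lra).
    replace (dW t) with (dV t + (dW t - dV t)) by ring.
    apply (is_derive_plus (cot_defect p)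
      (fun t => sin (w * t) * cot_gap t / w - (ln t - ln (sin t)))).
    - apply HV; lra.
    - unfold dV, dW, cot_gap; auto_derive.
      + repeat split; lra.
      + pose proof (sin2_cos2 t) as E; unfold Rsqr in E.
        replace (/ sin t ^ 2)
          with ((sin t * sin t + cos t * cos t) / sin t ^ 2)
          by (rewrite E; field; lra).
        field; lra. }
  assert (H2 : Rabs (W (PI / 2) - W e) <= / sin e ^ 2 / w * (PI / 2 - e)).
  { apply mean_value_bound with dW; try lra.
    - apply Rmult_le_pos; apply Rlt_le, Rinv_0_lt_compat; [apply pow_lt|]; lra.
    - intros t Ht; apply HW; lra.
    - intros t Ht; eapply is_derive_continuity_pt, HW; lra.
    - intros t Ht; unfold dW, Rdiv.
      destruct (half_pi_sin_pos e t ltac:(lra) ltac:(lra)) as [_ Hst].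
      pose proof (sin_bounds t ltac:(lra)) as Hsb.
      assert (/ sin t ^ 2 <= / sin e ^ 2).
      { apply Rinv_le_contravar; [apply pow_lt; lra | apply pow_incr; lra]. }
      assert (/ t ^ 2 <= / sin t ^ 2).
      { apply Rinv_le_contravar; [apply pow_lt; lra | apply pow_incr; lra]. }
      assert (0 < / t ^ 2) by (apply Rinv_0_lt_compat, pow_lt; lra).
      rewrite Rabs_mult, (Rabs_pos_eq (/ w))
        by (apply Rlt_le, Rinv_0_lt_compat; lra).
      apply Rmult_le_compat_r; [apply Rlt_le, Rinv_0_lt_compat; lra|].
      rewrite Rabs_mult, (Rabs_pos_eq (_ - _)) by lra.
      assert (Rabs (sin (w * t)) <= 1) by (apply Rabs_le, SIN_bound).
      pose proof (Rabs_pos (sin (w * t))); nra. }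
  assert (H3 : W (PI / 2) = cot_defect p (PI / 2) - ln (PI / 2)).
  { unfold W, w; rewrite sin_PI2, ln_1.
    replace (2 * INR (S p) * (PI / 2)) with (INR (S p) * PI) by field.
    rewrite sin_INR_PI; unfold Rdiv; ring. }
  assert (H4 : Rabs (sin (w * e) * cot_gap e / w) <= 1 / w).
  { unfold Rdiv; rewrite Rabs_mult, (Rabs_pos_eq (/ w))
      by (apply Rlt_le, Rinv_0_lt_compat; lra).
    apply Rmult_le_compat_r; [apply Rlt_le, Rinv_0_lt_compat; lra|].
    pose proof (cot_gap_range e ltac:(lra)); pose proof (SIN_bound (w * e)).
    apply Rabs_le; nra. }
  rewrite <- H3.
  pose proof (ln_sinc_small e He) as H5.
  assert (H6 : / sin e ^ 2 / w * (PI / 2 - e) + 1 / w <= C / w).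
  { unfold C, Rdiv.
    assert (0 < / sin e ^ 2) by (apply Rinv_0_lt_compat, pow_lt; lra).
    assert (0 < / w) by (apply Rinv_0_lt_compat; lra).
    assert (0 < / sin e ^ 2 * / w * e)
      by (repeat apply Rmult_lt_0_compat; lra).
    lra. }
  assert (H7 : W e = cot_defect p e - (ln e - ln (sin e))
                     + sin (w * e) * cot_gap e / w) by (unfold W; ring).
  apply Rabs_le_between in H1, H2, H4; apply Rabs_le; lra.
Qed.

(** For [n = 2 M], the finite sum at [PI / 2] is [2 H_(2 M) - H_M] in terms of
    the harmonic numbers, hence [ln M + 2 ln 2 + gamma + o(1)]. *)
Lemma cin_log_lim :
  is_lim_seq (fun m => cin (2 * INR (S m) * PI) - ln (INR (S m)))
    (euler_gamma + ln (2 * PI)).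
Proof.
  pose proof PI_RGT_0 as HPI.
  set (h := fun n => sum_n (fun k => / INR (S k)) n - ln (INR (S n))).
  assert (Hsub : filterlim (fun n => S (2 * n)) eventually eventually)
    by (apply eventually_subseq; intros n; lia).
  apply is_lim_seq_ext with
    (fun m => cot_defect (S (2 * m)) (PI / 2)
              + (2 * h (S (2 * m)) - h m + 2 * ln 2)).
  - intros m; unfold cot_defect, h.
    assert (E : INR (S (S (2 * m))) = 2 * INR (S m)).
    { replace (S (S (2 * m))) with (2 * S m)%nat by lia.
      rewrite mult_INR; reflexivity. }
    pose proof (INR_S_pos m) as Hm.
    rewrite E, ln_mult by lra.
    replace (2 * (2 * INR (S m)) * (PI / 2)) with (2 * INR (S m) * PI) by field.
    replace (2 * INR (S m) * PI) with (0 + 2 * INR (S m) * PI) at 2 by ring.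
    rewrite cos_period, cos_0.
    rewrite (sum_n_ext _
      (fun k => (1 - cos (INR (S k) * PI)) * (fun i => / INR i) (S k))).
    2:{ intros k.
        replace (2 * INR (S k) * (PI / 2)) with (INR (S k) * PI) by field.
        reflexivity. }
    rewrite (sum_even_vanish (fun i => / INR i)).
    rewrite (sum_n_ext (fun k => / INR (2 * S k)) (fun k => / 2 * / INR (S k))).
    2:{ intros k; change (/ INR (2 * S k) = / 2 * / INR (S k) :> R).
        rewrite mult_INR; pose proof (INR_S_pos k).
        replace (INR 2) with 2 by reflexivity; field; lra. }
    rewrite sum_n_scal; field; lra.
  - replace (euler_gamma + ln (2 * PI)) with
      (ln (PI / 2) + (2 * euler_gamma - euler_gamma + 2 * ln 2)).
    + apply is_lim_seq_plus'.
      { apply (is_lim_seq_subseq (fun p => cot_defect p (PI / 2)));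
          [exact Hsub | apply cot_defect_lim]. }
      apply is_lim_seq_plus'; [|apply is_lim_seq_const].
      apply is_lim_seq_minus'; [|apply harmonic_lim].
      apply is_lim_seq_mult'; [apply is_lim_seq_const|].
      apply (is_lim_seq_subseq h); [exact Hsub | apply harmonic_lim].
    + rewrite ln_mult, ln_div by lra; ring.
Qed.
(** * The constant of Glaisher and Kinkelin *)

Definition log_sq (k : nat) : R := ln (INR (S k)) * inv_sq k.

Definition cin_constant : R := euler_gamma + ln (2 * PI).

Definition cin_error (n k : nat) : R :=
  cin (2 * INR (S k) * (INR (S n) * PI))
  - (ln (INR (S k)) + (ln (INR (S n)) + cin_constant)).

(** The cosine integral is evaluated at [2 PI] times a multiple of [n + 1], so
    that the error is small uniformly in [k]. *)
Lemma cin_error_small eps :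
  0 < eps -> exists n0, forall n k, (n0 <= n)%nat -> Rabs (cin_error n k) <= eps.
Proof.
  intros Heps; pose proof cin_log_lim as H; apply is_lim_seq_Reals in H.
  destruct (H eps Heps) as [n0 Hn0]; exists n0; intros n k Hn.
  specialize (Hn0 (n + k * S n)%nat ltac:(lia)).
  replace (INR (S (n + k * S n))) with (INR (S k) * INR (S n)) in Hn0
    by (rewrite <- mult_INR; f_equal; lia).
  rewrite ln_mult in Hn0 by apply INR_S_pos.
  unfold cin_error, cin_constant; unfold R_dist in Hn0.
  apply Rlt_le; eapply Rle_lt_trans; [right | exact Hn0].
  rewrite <- (Rmult_assoc (2 * INR (S k))), (Rmult_assoc 2 (INR (S k))).
  f_equal; ring.
Qed.

Lemma cin_series (N : nat) :
  is_series (fun k => cin (2 * INR (S k) * (INR N * PI)) * inv_sq k)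
    (PI ^ 2 * glaisher_log N).
Proof. exact (cin_sum_lim N). Qed.

Lemma is_series_inv_sq_scal (c : R) :
  is_series (fun k => c * inv_sq k) (c * (PI ^ 2 / 6)).
Proof.
  rewrite <- basel.
  exact (is_series_scal c _ _ (Series_correct _ ex_series_inv_sq)).
Qed.

(** The series [sum_k Cin (2 k N PI) / k^2] converges, and for a suitable [N]
    the coefficient [Cin (2 k N PI)] differs from [ln k] by a bounded amount. *)
Lemma ex_series_log_sq : ex_series log_sq.
Proof.
  destruct (cin_error_small 1 Rlt_0_1) as [n Hn].
  set (c := ln (INR (S n)) + cin_constant).
  apply ex_series_ext with
    (fun k => plus (cin (2 * INR (S k) * (INR (S n) * PI)) * inv_sq k)
                   (opp (plus (cin_error n k * inv_sq k) (c * inv_sq k)))).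
  - intros k; change (cin (2 * INR (S k) * (INR (S n) * PI)) * inv_sq k
      - (cin_error n k * inv_sq k + c * inv_sq k) = log_sq k).
    unfold cin_error, log_sq; fold c; ring.
  - apply (ex_series_minus _ (fun k => plus (cin_error n k * inv_sq k) (c * inv_sq k))).
    + eexists; apply cin_series.
    + apply (ex_series_plus (fun k => cin_error n k * inv_sq k)).
      * apply ex_series_bounded_inv_sq with 1; intros k; apply Hn; lia.
      * eexists; apply is_series_inv_sq_scal.
Qed.

(** The two evaluations of the integral over [[0, N * PI]] are compared; their
    difference is a series whose coefficients [cin_error] are uniformly small. *)
Lemma glaisher_log_lim :
  is_lim_seq (fun n => glaisher_log (S n) - ln (INR (S n)) / 6)
    (cin_constant / 6 + Series log_sq / PI ^ 2).
Proof.
  pose proof PI_RGT_0 as HPI.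
  apply is_lim_seq_Reals; intros eps Heps.
  destruct (cin_error_small eps Heps) as [n0 Hn0]; exists n0; intros n Hn.
  specialize (fun k => Hn0 n k Hn); unfold R_dist.
  set (c := ln (INR (S n)) + cin_constant).
  set (D := PI ^ 2 * glaisher_log (S n) - (Series log_sq + c * (PI ^ 2 / 6))).
  assert (HD : is_series (fun k => cin_error n k * inv_sq k) D).
  { apply is_series_ext with
      (fun k => plus (cin (2 * INR (S k) * (INR (S n) * PI)) * inv_sq k)
                     (opp (plus (log_sq k) (c * inv_sq k)))).
    - intros k; change (cin (2 * INR (S k) * (INR (S n) * PI)) * inv_sq k
        - (log_sq k + c * inv_sq k) = cin_error n k * inv_sq k).
      unfold cin_error, log_sq; fold c; ring.
    - apply (is_series_minus _ (fun k => plus (log_sq k) (c * inv_sq k))).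
      + apply cin_series.
      + apply (is_series_plus log_sq).
        * exact (Series_correct _ ex_series_log_sq).
        * apply is_series_inv_sq_scal. }
  assert (HDb : Rabs D <= eps * (PI ^ 2 / 6)).
  { rewrite <- (is_series_unique _ _ HD).
    rewrite <- (is_series_unique _ _ (is_series_inv_sq_scal eps)).
    assert (Habs : forall k, Rabs (cin_error n k * inv_sq k)
                             = Rabs (cin_error n k) * inv_sq k).
    { intros k; rewrite Rabs_mult; f_equal.
      apply Rabs_pos_eq, Rlt_le, inv_sq_pos. }
    eapply Rle_trans; [apply Series_Rabs|].
    - apply ex_series_ext with (fun k => Rabs (cin_error n k) * inv_sq k);
        [intros k; symmetry; apply Habs|].
      apply ex_series_bounded_inv_sq with eps; intros k.
      rewrite Rabs_Rabsolu; apply Hn0.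
    - apply Series_le; [|eexists; apply is_series_inv_sq_scal].
      intros k; split; [apply Rabs_pos|]; rewrite Habs.
      apply Rmult_le_compat_r; [apply Rlt_le, inv_sq_pos | apply Hn0]. }
  replace (_ - (cin_constant / 6 + _)) with (D / PI ^ 2)
    by (unfold D, c; field; lra).
  assert (HP2 : 0 < PI ^ 2) by (apply pow_lt; lra).
  unfold Rdiv; rewrite Rabs_mult, (Rabs_pos_eq (/ PI ^ 2))
    by (apply Rlt_le, Rinv_0_lt_compat; lra).
  apply Rle_lt_trans with (eps * (PI ^ 2 / 6) * / PI ^ 2).
  - apply Rmult_le_compat_r; [apply Rlt_le, Rinv_0_lt_compat; lra | exact HDb].
  - replace (eps * (PI ^ 2 / 6) * / PI ^ 2) with (eps / 6) by (field; lra); lra.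
Qed.

Lemma hyperfactorial_exp n :
  prod_f_R0 (fun k => INR k ^ k) n =
  exp (sum_n (fun k => INR k * ln (INR k)) n).
Proof.
  induction n as [|n IH].
  - rewrite sum_O; simpl; rewrite Rmult_0_l, exp_0; reflexivity.
  - rewrite sum_n_succ, exp_plus, <- IH.
    change (prod_f_R0 (fun k => INR k ^ k) (S n))
      with (prod_f_R0 (fun k => INR k ^ k) n * INR (S n) ^ S n).
    f_equal; rewrite <- Rpower_pow by apply INR_S_pos; reflexivity.
Qed.

Lemma exp_quotient x y : exp x / exp y = exp (x - y).
Proof. unfold Rdiv, Rminus; now rewrite exp_plus, exp_Ropp. Qed.

Lemma glaisher_A_eq :
  glaisher_A = exp ((cin_constant / 6 + Series log_sq / PI ^ 2) / 2).
Proof.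
  unfold glaisher_A; set (c := (_ + _) / 2).
  rewrite (is_lim_seq_unique _ (exp c)); [reflexivity|].
  apply is_lim_seq_incr_1.
  apply is_lim_seq_ext with
    (fun n => exp ((glaisher_log (S n) - ln (INR (S n)) / 6) * / 2)).
  - intros n; rewrite hyperfactorial_exp; unfold Rpower.
    rewrite <- exp_plus, exp_quotient.
    f_equal; unfold glaisher_log; field.
  - apply (is_lim_seq_continuous exp
             (fun n => (glaisher_log (S n) - ln (INR (S n)) / 6) * / 2)).
    + apply derivable_continuous_pt, derivable_pt_exp.
    + apply is_lim_seq_mult'; [apply glaisher_log_lim | apply is_lim_seq_const].
Qed.

(** * The product *)

Lemma root_sq_exp k : root_sq (INR (S k)) = exp (log_sq k).
Proof.
  unfold root_sq, Rpower, log_sq, inv_sq; f_equal.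
  pose proof (INR_S_pos k); field; lra.
Qed.

Lemma wallis_factor_exp i :
  wallis_factor (S i) =
  exp (2 * log_sq (3 * i + 2) - log_sq (3 * i + 1) - log_sq (3 * i + 3)).
Proof.
  unfold wallis_factor.
  replace (3 * INR (S i) - 1) with (INR (S (3 * i + 1)))
    by (rewrite !S_INR, plus_INR, mult_INR; simpl; ring).
  replace (3 * INR (S i) + 1) with (INR (S (3 * i + 3)))
    by (rewrite !S_INR, plus_INR, mult_INR; simpl; ring).
  replace (3 * INR (S i)) with (INR (S (3 * i + 2)))
    by (rewrite !S_INR, plus_INR, mult_INR; simpl; ring).
  rewrite !root_sq_exp, <- !exp_plus, exp_quotient; f_equal; ring.
Qed.

Lemma log_sq_triple i :
  3 * log_sq (3 * i + 2) = / 3 * (ln 3 * inv_sq i + log_sq i).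
Proof.
  unfold log_sq, inv_sq.
  replace (INR (S (3 * i + 2))) with (3 * INR (S i))
    by (rewrite !S_INR, plus_INR, mult_INR; simpl; ring).
  pose proof (INR_S_pos i); rewrite ln_mult by lra; field; lra.
Qed.

(** The multiples of [3] occur with coefficient [2 = 3 - 1] and the other
    integers with coefficient [-1]. *)
Lemma wallis_product_exp N :
  prod_f_R0 (fun i => wallis_factor (S i)) N =
  exp (/ 3 * (ln 3 * sum_n inv_sq N + sum_n log_sq N)
       - sum_n log_sq (S (S (S (3 * N))))).
Proof.
  induction N as [|N IH].
  - change (prod_f_R0 (fun i => wallis_factor (S i)) 0) with (wallis_factor 1).
    rewrite wallis_factor_exp; f_equal.
    pose proof (log_sq_triple 0) as H.
    change (3 * 0)%nat with 0%nat in *; rewrite !sum_n_succ, !sum_O.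
    change (0 + 1)%nat with 1%nat; change (0 + 2)%nat with 2%nat in *.
    change (0 + 3)%nat with 3%nat.
    assert (log_sq 0 = 0) by (unfold log_sq; simpl; rewrite ln_1; ring).
    lra.
  - change (prod_f_R0 (fun i => wallis_factor (S i)) (S N))
      with (prod_f_R0 (fun i => wallis_factor (S i)) N * wallis_factor (S (S N))).
    rewrite IH, wallis_factor_exp, <- exp_plus; f_equal.
    pose proof (log_sq_triple (S N)) as H.
    set (m := S (S (S (3 * N)))).
    replace (S (S (S (3 * S N)))) with (S (S (S m))) by (unfold m; lia).
    rewrite !(sum_n_succ _ N), (sum_n_succ _ (S (S m))), (sum_n_succ _ (S m)),
      (sum_n_succ _ m).
    replace (3 * S N + 1)%nat with (S m) by (unfold m; lia).
    replace (3 * S N + 2)%nat with (S (S m)) in * by (unfold m; lia).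
    replace (3 * S N + 3)%nat with (S (S (S m))) by (unfold m; lia).
    lra.
Qed.

Lemma closed_form_exp :
  Rpower (3 * (2 * PI * exp euler_gamma / glaisher_A ^ 12) ^ 2) (PI ^ 2 / 18) =
  exp (/ 3 * (ln 3 * (PI ^ 2 / 6) + Series log_sq) - Series log_sq).
Proof.
  pose proof PI_RGT_0 as HPI; unfold Rpower; f_equal.
  set (L := Series log_sq).
  assert (E : 2 * PI * exp euler_gamma / glaisher_A ^ 12
              = exp (- (6 * L / PI ^ 2))).
  { assert (H12 : glaisher_A ^ 12 = exp (cin_constant + 6 * L / PI ^ 2)).
    { rewrite glaisher_A_eq, <- Rpower_pow by apply exp_pos.
      unfold Rpower; rewrite ln_exp; f_equal; fold L.
      replace (INR 12) with 12 by (simpl; ring); field; lra. }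
    rewrite H12, <- (exp_ln (2 * PI)), <- exp_plus, exp_quotient by lra.
    f_equal; unfold cin_constant; ring. }
  rewrite E, ln_mult by (lra || apply pow_lt, exp_pos).
  rewrite <- (Rpower_pow 2 (exp _)) by apply exp_pos.
  unfold Rpower; rewrite !ln_exp.
  replace (INR 2) with 2 by reflexivity; field; lra.
Qed.

Lemma wallis_product_lim :
  is_lim_seq (fun N => prod_f_R0 (fun i => wallis_factor (S i)) N)
    (Rpower (3 * (2 * PI * exp euler_gamma / glaisher_A ^ 12) ^ 2)
            (PI ^ 2 / 18)).
Proof.
  rewrite closed_form_exp.
  eapply is_lim_seq_ext; [intros N; symmetry; apply wallis_product_exp|].
  apply (is_lim_seq_continuous exp).
  { apply derivable_continuous_pt, derivable_pt_exp. }
  assert (Hq : is_lim_seq (sum_n inv_sq) (PI ^ 2 / 6)).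
  { rewrite <- basel; exact (Series_correct _ ex_series_inv_sq). }
  assert (HL : is_lim_seq (sum_n log_sq) (Series log_sq))
    by exact (Series_correct _ ex_series_log_sq).
  apply is_lim_seq_minus'.
  - apply is_lim_seq_mult'; [apply is_lim_seq_const|].
    apply is_lim_seq_plus'; [|exact HL].
    apply is_lim_seq_mult'; [apply is_lim_seq_const | exact Hq].
  - apply (is_lim_seq_subseq (sum_n log_sq)); [|exact HL].
    apply eventually_subseq; intros n; lia.
Qed.

Lemma wallis_product_shift N :
  wallis_factor 1 * wallis_factor 2 * wallis_factor 3
  * prod_f_R0 (fun i => wallis_factor (i + 4)) N =
  prod_f_R0 (fun i => wallis_factor (S i)) (N + 3).
Proof.
  induction N as [|N IH]; [reflexivity|].
  change (prod_f_R0 (fun i => wallis_factor (i + 4)) (S N))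
    with (prod_f_R0 (fun i => wallis_factor (i + 4)) N * wallis_factor (S N + 4)).
  rewrite <- Rmult_assoc, IH.
  change (S N + 3)%nat with (S (N + 3)).
  change (prod_f_R0 (fun i => wallis_factor (S i)) (S (N + 3)))
    with (prod_f_R0 (fun i => wallis_factor (S i)) (N + 3)
          * wallis_factor (S (S (N + 3)))).
  do 2 f_equal; lia.
Qed.

Theorem mainTheorem8 :
  is_lim_seq (fun N => prod_f_R0 (fun i => wallis_factor (S i)) N)
    (Finite (Rpower (3 * (2 * PI * exp euler_gamma / glaisher_A ^ 12) ^ 2)
                    (PI ^ 2 / 18)))
  /\
  is_lim_seq
    (fun N =>
      ((Rpower 3 (1 / 3 ^ 2) * Rpower 3 (1 / 3 ^ 2)) /
       (Rpower 2 (1 / 2 ^ 2) * Rpower 4 (1 / 4 ^ 2))) *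
      ((Rpower 6 (1 / 6 ^ 2) * Rpower 6 (1 / 6 ^ 2)) /
       (Rpower 5 (1 / 5 ^ 2) * Rpower 7 (1 / 7 ^ 2))) *
      ((Rpower 9 (1 / 9 ^ 2) * Rpower 9 (1 / 9 ^ 2)) /
       (Rpower 8 (1 / 8 ^ 2) * Rpower 10 (1 / 10 ^ 2))) *
      prod_f_R0 (fun i => wallis_factor (i + 4)) N)
    (Finite (Rpower (3 * (2 * PI * exp euler_gamma / glaisher_A ^ 12) ^ 2)
                    (PI ^ 2 / 18))).
Proof.
  split; [exact wallis_product_lim|].
  assert (Hnum : forall (n : nat) (x y z : R),
            3 * INR n = y -> y - 1 = x -> y + 1 = z ->
            (Rpower y (1 / y ^ 2) * Rpower y (1 / y ^ 2)) /
            (Rpower x (1 / x ^ 2) * Rpower z (1 / z ^ 2)) = wallis_factor n).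
  { intros n x y z Hy <- <-; unfold wallis_factor, root_sq; now rewrite Hy. }
  rewrite (Hnum 1%nat 2 3 4), (Hnum 2%nat 5 6 7), (Hnum 3%nat 8 9 10)
    by (simpl; ring).
  eapply is_lim_seq_ext; [intros N; symmetry; apply wallis_product_shift|].
  apply (is_lim_seq_incr_n
           (fun N => prod_f_R0 (fun i => wallis_factor (S i)) N) 3).
  exact wallis_product_lim.
Qed.
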